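(* Let $F=(f_1,\dots,f_N)$ be a system of polynomials in $\mathbb{C}[x_1,\dots,x_n]$ and let $\boldsymbol{x}^*\in\mathbb{C}^n$ be an isolated multiple solution of $F(\boldsymbol{x})=\boldsymbol{0}$. Let $A(\boldsymbol{x})$ be the Jacobian matrix of $F$. For a generic vector $\gamma=(\gamma_1,\dots,\gamma_n)\in\ker A(\boldsymbol{x}^* )$, put $H(t)=F(\boldsymbol{x}^*+\gamma t)=F(x_1^*+\gamma_1t,\dots,x_n^*+\gamma_nt)$ and $$d=\min\{a \mid a \text{ belongs to the support of } H(t)\}-1.$$ Then $d$ is the minimal positive integer such that the augmented system $G^{(d)}(\boldsymbol{x})$ produced via a generic deflation operator $Q$ of order $d$ has the property that the corank of its Jacobian matrix at $\boldsymbol{x}^*$ is lower than $\operatorname{corank}A(\boldsymbol{x}^* )$.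
   Context: For $\alpha\in\mathbb{Z}_{\ge0}^n$, $|\alpha|=\alpha_1+\dots+\alpha_n$ and $\partial^\beta=\frac{\partial^{|\beta|}}{\partial x_1^{\beta_1}\cdots\partial x_n^{\beta_n}}$. The support of $H(t)$, a vector of univariate polynomials in $t$, is the set of exponents $a$ such that $t^a$ occurs with nonzero coefficient in some component of $H$. The corank of a matrix is the dimension of its kernel (number of columns minus rank). A multiple solution is one of multiplicity greater than one; equivalently, $\operatorname{corank} A(\boldsymbol{x}^* )>0$. Deflation matrix: for an integer $e\ge1$, $A^{(e)}(\boldsymbol{x})$ is the matrix whose rows are indexed by $\boldsymbol{x}^\alpha f_j$ with $|\alpha|<e$, $j=1,\dots,N$, whose columns are indexed by $\partial^\beta$ with $\beta\ne\boldsymbol{0}$, $|\beta|\le e$, and whose entry in row $\boldsymbol{x}^\alpha f_j$ and column $\partial^\beta$ is $\partial^\beta(\boldsymbol{x}^\alpha f_j)$. A deflation operator of order $e$ is a constant-coefficient differential operator $Q=\sum_{\beta\ne\boldsymbol{0},\,|\beta|\le e}\lambda_\beta\partial^\beta$ where $(\lambda_\beta)$ is a nonzero vector in $\ker A^{(e)}(\boldsymbol{x}^* )$; it is generic if this vector is generic in $\ker A^{(e)}(\boldsymbol{x}^* )$. The augmented system $G^{(e)}(\boldsymbol{x})$ produced via $Q$ consists of the polynomials $f_j$ ($j=1,\dots,N$) together with $g_{j,\alpha}(\boldsymbol{x})=Q\cdot(\boldsymbol{x}^\alpha f_j)$ ($j=1,\dots,N$, $|\alpha|<e$). ''Generic''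 means outside some proper Zariski-closed subset of the vector space in question. *)

(* Defs.v *)
From HB Require Import structures.
From mathcomp Require Import all_boot all_order all_algebra.
From mathcomp Require Import mpoly complex reals.

Set Implicit Arguments.
Unset Strict Implicit.
Unset Printing Implicit Defensive.

Import Order.TTheory GRing.Theory Num.Theory.
Local Open Scope ring_scope.

(* Points, kernel vectors and polynomial systems are all column vectors. *)

Definition is_min (S : nat -> Prop) (m : nat) : Prop :=
  S m /\ forall k, S k -> (m <= k)%N.

Section Genericity.
Variables (K : fieldType) (k : nat).
Implicit Types (V Z P : 'cV[K]_k -> Prop).

Definition zariski_closed Z : Prop :=
  exists S : {mpoly K[k]} -> Prop,
    forall v, Z v <-> forall p, S p -> p.@[fun i => v i 0] = 0.

(* The closed subset of V in question is the trace on V of the ambient closed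
   set Z; polynomial functions on a linear subspace extend to the whole space. *)
Definition generic_in V P : Prop :=
  exists Z, [/\ zariski_closed Z,
                exists v, V v /\ ~ Z v
              & forall v, V v -> ~ Z v -> P v].

End Genericity.

Section Corank.
Variables (K : fieldType) (m k : nat).

(* mxalgebra's kermx is the left kernel; column vectors need the right one. *)
Definition rker (A : 'M[K]_(m, k)) (v : 'cV[K]_k) : Prop := A *m v = 0.

Definition corank (A : 'M[K]_(m, k)) : nat := (k - \rank A)%N.

End Corank.

Section System.
Variables (K : fieldType) (n N : nat).
Implicit Types (F : 'cV[{mpoly K[n]}]_N) (x gamma : 'cV[K]_n).

Definition eval_mx a b (M : 'M[{mpoly K[n]}]_(a, b)) x : 'M[K]_(a, b) :=
  map_mx (meval (fun i => x i 0)) M.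

Definition jacobian F : 'M[{mpoly K[n]}]_(N, n) :=
  \matrix_(j, i) (F j 0)^`M(i).

Definition is_solution F x : Prop := eval_mx F x = 0.

Definition in_ideal F (p : {mpoly K[n]}) : Prop :=
  exists a : 'I_N -> {mpoly K[n]}, p = \sum_j a j * F j 0.

(* The local algebra of F at x, i.e. the localization of K[x_1, ..., x_n] at
   the maximal ideal of x modulo the ideal generated by F, has dimension at
   least k.  A fraction p / q with q(x) <> 0 is p times a unit, and p vanishes
   in the local algebra iff s * p lies in the ideal for some s with s(x) <> 0;
   clearing a common denominator, k independent elements can be taken to be
   polynomials. *)
Definition multiplicity_ge F x (k : nat) : Prop :=
  exists u : 'I_k -> {mpoly K[n]}, forall c : 'I_k -> K,
    (exists s : {mpoly K[n]},
       s.@[fun i => x i 0] != 0 /\ in_ideal F (s * \sum_i c i *: u i)) ->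
    forall i, c i = 0.

Definition is_multiple F x : Prop := multiplicity_ge F x 2.

(* H(t) = F(x + gamma t) *)
Definition line_restriction F x gamma : 'cV[{poly K}]_N :=
  map_mx (mmap polyC (fun i => (x i 0)%:P + gamma i 0 *: 'X)) F.

Definition line_support (H : 'cV[{poly K}]_N) (a : nat) : Prop :=
  exists j, (H j 0)`_a != 0.

End System.

(* For K = R[i], 0 < eps says that eps is a positive real number. *)
Definition isolated_solution (K : numFieldType) (n N : nat)
    (F : 'cV[{mpoly K[n]}]_N) (x : 'cV[K]_n) : Prop :=
  is_solution F x /\
  exists eps : K, 0 < eps /\
    forall y, is_solution F y -> (forall i, `|y i 0 - x i 0| < eps) -> y = x.

Section Deflation.
Variables (K : fieldType) (n N : nat).
Implicit Types (F : 'cV[{mpoly K[n]}]_N) (x : 'cV[K]_n).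

(* The bound in 'X_{1..n < e} is strict: these are the exponents alpha with
   |alpha| < e. The index (j, alpha) stands for the polynomial x^alpha f_j. *)
Definition row_index (e : nat) := ('I_N * 'X_{1..n < e})%type.

(* exponents beta <> 0 with |beta| <= e *)
Definition col_index (e : nat) :=
  {b : 'X_{1..n < e.+1} | (b : 'X_{1..n}) != 0%MM}.

Definition row_poly F e (r : 'I_#|{: row_index e}|) : {mpoly K[n]} :=
  'X_[(enum_val r).2] * F (enum_val r).1 0.

Definition col_exp e (c : 'I_#|{: col_index e}|) : 'X_{1..n} :=
  val (val (enum_val c)).

Definition deflation_mx F e :
    'M[{mpoly K[n]}]_(#|{: row_index e}|, #|{: col_index e}|) :=
  \matrix_(r, c) (row_poly F r)^`M[col_exp c].

Definition diff_op e (lambda : 'cV[K]_#|{: col_index e}|) (p : {mpoly K[n]}) :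
    {mpoly K[n]} :=
  \sum_c lambda c 0 *: p^`M[col_exp c].

Definition augmented F e (lambda : 'cV[K]_#|{: col_index e}|) :
    'cV[{mpoly K[n]}]_(N + #|{: row_index e}|) :=
  col_mx F (\col_r diff_op lambda (row_poly F r)).

Definition generic_deflation_lowers_corank F x e : Prop :=
  generic_in (rker (eval_mx (deflation_mx F e) x)) (fun lambda =>
    lambda != 0 ->
    (corank (eval_mx (jacobian (augmented F lambda)) x)
       < corank (eval_mx (jacobian F) x))%N).

End Deflation.

(* Main.v *)
Require Import Defs.
From mathcomp Require Import all_boot all_order all_algebra.
From mathcomp Require Import mpoly complex reals.
From HB Require Import structures.
From mathcomp Require Import boolp zify.

(** Write W for the kernel of the Jacobian matrix at x, m for the maximal ideal
    of x, and ell_k for the linear part of f_k at x, so that W is the common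
    zero set of the ell_k.  A vector lambda lies in the kernel of the deflation
    matrix of order e iff Q_lambda, followed by evaluation at x, kills the whole
    ideal I of F: multiples p f_j with p in m^e are killed because the operator
    has order e and f_j vanishes at x ([deflation_kills_ideal]).  The corank
    drops iff some derivative d_v Q_lambda with v in W fails to kill some
    x^alpha f_j ([corank_col_mx_lt]).

    Let d+1 be the least order at which some f_j is nonzero along some line
    through x directed by W.  It exists because W is nonzero, x being multiple
    ([multiple_singular], a form of Nakayama's lemma), and because x is
    isolated, so that F does not vanish on a line ([isolated_leaves]); and
    d > 0 since ell_k vanishes on W.  The coefficient of t^(d+1) in
    f_j(x + gamma t) is polynomial in gamma, so d+1 is the least exponent of
    H(t) for every gamma outside a closed set.

    Order d suffices ([deflation_lowers_corank]).  The d-th derivative in the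
    direction of gamma belongs to the kernel, and differentiating it once more
    along gamma detects the coefficient of t^(d+1) of some f_j.  The value of
    d_gamma Q_lambda f_j at x is a linear form in lambda, so its nonvanishing is
    a generic condition.

    An order e < d does not ([deflation_keeps_corank]).  Projecting onto W shows
    that f_k is ell_k plus a combination of the ell_l with coefficients in m plus
    an element of m^(d+1) ([flat_decomposition]).  So F and the ell_l generate
    the same ideal modulo m^(d+1): Q_lambda kills the ideal of the ell_l
    ([deflation_kills_linear_part]), which is stable under d_v for v in W, hence
    d_v Q_lambda kills I too.  Then every element of the kernel leaves the
    corank unchanged, and the kernel contains nonzero elements outside every
    closed set that does not contain it ([generic_nonzero]). *)

Set Implicit Arguments.
Unset Strict Implicit.
Unset Printing Implicit Defensive.

Import Order.TTheory GRing.Theory Num.Theory.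
Local Open Scope ring_scope.

Local Notation "p @@ x" := (p.@[fun i => x i 0%R]) (at level 10).

(** * Polynomials along lines *)
Section Polynomials.
Variables (K : numFieldType) (n : nat).
Implicit Types (p q : {mpoly K[n]}) (x y gamma : 'cV[K]_n) (i : 'I_n).

(** Suited to statements about algebra morphisms and derivations, which are
    determined by the variables. *)
Lemma mpoly_alg_ind (P : {mpoly K[n]} -> Prop) :
  (forall c, P c%:MP) -> (forall i, P 'X_i) ->
  (forall p q, P p -> P q -> P (p + q)) ->
  (forall p q, P p -> P q -> P (p * q)) -> forall p, P p.
Proof.
move=> PC PX PD PM; elim/mpolyind=> [|c m p _ _ Pp]; first by rewrite -mpolyC0.
apply: (PD _ _ _ Pp); rewrite -mul_mpolyC mpolyXE_id; apply: (PM) => //.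
elim/big_rec: _ => [|i q _ Pq]; first by rewrite -mpolyC1.
apply: (PM _ _ _ Pq); elim: (m i) => [|k IHk]; first by rewrite expr0 -mpolyC1.
by rewrite exprS; apply: (PM _ _ _ IHk).
Qed.

Lemma poly_vanish (p : {poly K}) : (forall s, p.[s] = 0) -> p = 0.
Proof.
move=> p0; apply/eqP/negPn/negP => nz_p.
pose rs : seq K := [seq k%:R | k <- iota 0 (size p)].
suff: (size rs < size p)%N by rewrite size_map size_iota ltnn.
apply: max_poly_roots => //; first by apply/allP => s _; apply/rootP.
rewrite map_inj_in_uniq ?iota_uniq // => k l _ _ /eqP.
by rewrite eqr_nat => /eqP.
Qed.

Definition on_line x gamma p : {poly K} :=
  mmap polyC (fun i => (x i 0)%:P + gamma i 0 *: 'X) p.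

HB.instance Definition _ x gamma :=
  GRing.RMorphism.copy (on_line x gamma)
    (mmap polyC (fun i => (x i 0)%:P + gamma i 0 *: 'X)).

Lemma on_lineE x gamma p : on_line x gamma p =
  mmap polyC (fun i => (x i 0)%:P + gamma i 0 *: 'X) p.
Proof. by []. Qed.

Lemma on_lineC x gamma c : on_line x gamma c%:MP = c%:P.
Proof. exact: mmapC. Qed.

Lemma on_lineX x gamma i : on_line x gamma 'X_i = (x i 0)%:P + gamma i 0 *: 'X.
Proof. by rewrite /on_line mmapX mmap1U. Qed.

Lemma on_lineD x gamma : {morph on_line x gamma : p q / p + q}.
Proof. exact: rmorphD. Qed.

Lemma on_lineM x gamma : {morph on_line x gamma : p q / p * q}.
Proof. exact: rmorphM. Qed.

Lemma on_lineZ x gamma c p : on_line x gamma (c *: p) = c *: on_line x gamma p.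
Proof. by rewrite /on_line mmapZ mul_polyC. Qed.

Lemma on_line0 x gamma : on_line x gamma 0 = 0.
Proof. exact: raddf0. Qed.

Lemma horner_on_line x gamma p s :
  (on_line x gamma p).[s] = p @@ (x + s *: gamma).
Proof.
elim/mpoly_alg_ind: p => [c|i|p q IHp IHq|p q IHp IHq].
- by rewrite on_lineC hornerC mevalC.
- by rewrite on_lineX mevalXU !mxE !hornerE mulrC.
- by rewrite on_lineD hornerD IHp IHq mevalD.
- by rewrite on_lineM hornerM IHp IHq mevalM.
Qed.

Lemma coef0_on_line x gamma p : (on_line x gamma p)`_0 = p @@ x.
Proof.
rewrite -horner_coef0 horner_on_line; apply: meval_eq => i.
by rewrite scale0r addr0.
Qed.

Definition dirder gamma p : {mpoly K[n]} := \sum_i gamma i 0 *: p^`M(i).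

Lemma dirderD gamma p q : dirder gamma (p + q) = dirder gamma p + dirder gamma q.
Proof.
by rewrite /dirder -big_split; apply: eq_bigr => i _; rewrite mderivD scalerDr.
Qed.

Lemma dirderM gamma p q :
  dirder gamma (p * q) = dirder gamma p * q + p * dirder gamma q.
Proof.
rewrite /dirder mulr_suml mulr_sumr -big_split; apply: eq_bigr => i _ /=.
by rewrite mderivM scalerDr scalerAl scalerAr.
Qed.

Lemma dirder0 gamma : dirder gamma 0 = 0.
Proof. by rewrite /dirder big1 // => i _; rewrite mderiv0 scaler0. Qed.

Lemma dirder_sum gamma I (r : seq I) (u : I -> {mpoly K[n]}) :
  dirder gamma (\sum_(k <- r) u k) = \sum_(k <- r) dirder gamma (u k).
Proof.
by elim/big_rec2: _ => [|k _ v _ <-]; rewrite ?dirder0 ?dirderD.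
Qed.

Lemma dirderC gamma c : dirder gamma c%:MP = 0.
Proof. by rewrite /dirder big1 // => i _; rewrite mderivC scaler0. Qed.

Lemma dirderX gamma i : dirder gamma 'X_i = (gamma i 0)%:MP.
Proof.
rewrite /dirder (bigD1 i) //= mderivX mnm1E eqxx scale1r.
rewrite -[X in (X - _)%MM]add0m addmK mpolyX0.
rewrite big1 ?addr0 ?alg_mpolyC // => j ne_ji.
by rewrite mderivX mnm1E eq_sym (negbTE ne_ji) scale0r scaler0.
Qed.

Lemma dirderZ gamma c p : dirder gamma (c *: p) = c *: dirder gamma p.
Proof. by rewrite -!mul_mpolyC dirderM dirderC mul0r add0r. Qed.

Lemma dirder_delta i p : dirder (delta_mx i 0) p = p^`M(i).
Proof.
rewrite /dirder (bigD1 i) //= mxE !eqxx scale1r big1 ?addr0 // => j ne_ji.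
by rewrite mxE (negbTE ne_ji) scale0r.
Qed.

Lemma mderiv_coord i j (a : K) :
  ('X_j - a%:MP)^`M(i) = ((j == i)%:R)%:MP_[n].
Proof.
rewrite -dirder_delta dirderD dirderX -mpolyCN dirderC addr0 mxE.
by rewrite eqxx andbT.
Qed.

Lemma deriv_on_line x gamma p :
  (on_line x gamma p)^`() = on_line x gamma (dirder gamma p).
Proof.
elim/mpoly_alg_ind: p => [c|i|p q IHp IHq|p q IHp IHq].
- by rewrite on_lineC derivC dirderC on_line0.
- by rewrite on_lineX dirderX on_lineC !derivE add0r alg_polyC.
- by rewrite dirderD !on_lineD derivD IHp IHq.
- by rewrite dirderM on_lineD !on_lineM derivM IHp IHq.
Qed.

Lemma coef_on_line_dirder x gamma a p :
  (on_line x gamma (dirder gamma p))`_a = (on_line x gamma p)`_a.+1 *+ a.+1.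
Proof. by rewrite -deriv_on_line coef_deriv. Qed.

Lemma eval_iter_dirder x gamma a p :
  (iter a (dirder gamma) p) @@ x = (on_line x gamma p)`_a *+ a`!.
Proof.
elim: a p => [|a IHa] p; first by rewrite coef0_on_line.
by rewrite iterSr IHa coef_on_line_dirder -mulrnA factS mulnC.
Qed.

(** On the line through y in the i-th direction the polynomial is zero, and the
    partial derivative is its coefficient of degree one. *)
Lemma mderiv_vanish i q :
  (forall y, q @@ y = 0) -> forall y, q^`M(i) @@ y = 0.
Proof.
move=> q0 y; have L0 : on_line y (delta_mx i 0) q = 0.
  by apply: poly_vanish => s; rewrite horner_on_line.
by rewrite -(coef0_on_line y (delta_mx i 0)) -dirder_delta -deriv_on_line
  L0 derivC coef0.
Qed.

(** The first property makes conditions on the line Zariski closed in its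
    direction; the second turns differentiation of p into differentiation with
    respect to the direction, the factor X shifting the order by one. *)
Lemma coef_on_line_polynomial x p a : exists c : {mpoly K[n]},
  (forall gamma, c @@ gamma = (on_line x gamma p)`_a) /\
  (forall i gamma, c^`M(i) @@ gamma = (on_line x gamma p^`M(i) * 'X)`_a).
Proof.
elim/mpoly_alg_ind: p a => [c|j|p q IHp IHq|p q IHp IHq] a.
- exists (if a == 0 then c else 0)%:MP; split=> [|i] gamma.
    by rewrite on_lineC coefC mevalC.
  by rewrite !mderivC on_line0 mul0r coef0 meval0.
- exists ((if a == 0 then x j 0 else 0)%:MP + (a == 1)%:R *: 'X_j).
  split=> [|i] gamma.
    by rewrite on_lineX coefD coefC coefZ coefX mevalD mevalC mevalZ mevalXU mulrC.
  have dE r : r^`M(i) = dirder (delta_mx i 0) r by rewrite dirder_delta.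
  rewrite !dE dirderD dirderC dirderZ dirderX add0r on_lineC mevalZ mevalC.
  by rewrite coefMX coefC; case: a => [|[|a]]; rewrite ?mul0r ?mul1r.
- have [c [cE dcE]] := IHp a; have [c' [cE' dcE']] := IHq a.
  exists (c + c'); split=> [|i] gamma.
    by rewrite on_lineD coefD mevalD cE cE'.
  by rewrite !mderivD on_lineD mulrDl coefD mevalD dcE dcE'.
have /fin_all_exists[c cP] (k : 'I_a.+1) := IHp k.
have /fin_all_exists[c' cP'] (k : 'I_a.+1) := IHq (a - k)%N.
exists (\sum_k c k * c' k); split=> [|i] gamma.
  rewrite on_lineM coefM rmorph_sum; apply: eq_bigr => k _ /=.
  by rewrite mevalM (cP k).1 (cP' k).1.
rewrite mderivM on_lineD !on_lineM mulrDl [X in X + _]mulrAC -[X in _ + X]mulrA.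
rewrite coefD !coefM (raddf_sum (mderiv i)) rmorph_sum -big_split.
apply: eq_bigr => k _ /=.
by rewrite mderivM mevalD !mevalM (cP k).1 (cP' k).1 (cP k).2 (cP' k).2.
Qed.

(** Over an infinite field this says that p belongs to the k-th power of the
    maximal ideal of x; testing on lines makes products and the restriction to
    a linear subspace immediate. *)
Definition ord_ge x k p :=
  forall gamma a, (a < k)%N -> (on_line x gamma p)`_a = 0.

Lemma ord_geD x k p q : ord_ge x k p -> ord_ge x k q -> ord_ge x k (p + q).
Proof.
by move=> op oq gamma a lt_ak; rewrite on_lineD coefD op ?oq ?addr0.
Qed.

Lemma ord_geZ x k c p : ord_ge x k p -> ord_ge x k (c *: p).
Proof. by move=> op gamma a lt_ak; rewrite on_lineZ coefZ op ?mulr0. Qed.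

Lemma ord_ge_sum x k I (r : seq I) (u : I -> {mpoly K[n]}) :
  (forall j, ord_ge x k (u j)) -> ord_ge x k (\sum_(j <- r) u j).
Proof.
move=> ou; elim/big_rec: _ => [|j p _ op]; last exact: ord_geD.
by move=> gamma a _; rewrite on_line0 coef0.
Qed.

Lemma ord_ge_le x k l p : (k <= l)%N -> ord_ge x l p -> ord_ge x k p.
Proof. by move=> le_kl op gamma a lt_ak; apply: op; apply: leq_trans le_kl. Qed.

Lemma ord_geM x k l p q :
  ord_ge x k p -> ord_ge x l q -> ord_ge x (k + l) (p * q).
Proof.
move=> op oq gamma a lt_a; rewrite on_lineM coefM big1 // => b _.
have [lt_bk|le_kb] := ltnP b k; first by rewrite op ?mul0r.
rewrite oq ?mulr0 // ltn_subLR -1?ltnS ?ltn_ord //.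
by apply: leq_trans lt_a _; rewrite leq_add2r.
Qed.

Lemma ord_ge1 x p : p @@ x = 0 -> ord_ge x 1 p.
Proof. by move=> p0 gamma [|//] _; rewrite coef0_on_line. Qed.

Lemma ord_ge_coord x i : ord_ge x 1 ('X_i - (x i 0)%:MP).
Proof. by apply: ord_ge1; rewrite mevalB mevalXU mevalC subrr. Qed.

(** The coefficients of order at most k, as polynomials in the direction,
    vanish at every point; so do their partial derivatives, which are the
    coefficients of the derivative along the line. *)
Lemma ord_ge_mderiv x k i p : ord_ge x k.+1 p -> ord_ge x k p^`M(i).
Proof.
move=> op gamma a lt_ak.
have [c [cE dcE]] := coef_on_line_polynomial x p a.+1.
have:= dcE i gamma; rewrite coefMX /= => <-.
by apply: mderiv_vanish => y; rewrite cE op.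
Qed.

Lemma ord_ge_mderivm x k m p : ord_ge x (k + mdeg m) p -> ord_ge x k p^`M[m].
Proof.
rewrite mderivm_foldr /=; set s := flatten _; have -> : mdeg m = size s.
  rewrite /s size_flatten /shape -map_comp mdegE sumnE big_map big_enum /=.
  by apply: eq_bigr => i _; rewrite size_nseq.
elim: s k => [|i s IHs] k /=; first by rewrite addn0.
by rewrite addnS -addSn => /IHs; apply: ord_ge_mderiv.
Qed.

(** The quotient by the ideal of the differences X_i - h_i identifies p with its
    image under the substitution.  Used for the constant substitution and for a
    projection onto a subspace. *)
Lemma sub_subst_ideal (h : 'I_n -> {mpoly K[n]}) p : exists a : 'I_n -> {mpoly K[n]},
  p - mmap (@mpolyC n K) h p = \sum_i a i * ('X_i - h i).
Proof.
elim/mpoly_alg_ind: p => [c|j|p q [a aE] [b bE]|p q [a aE] [b bE]].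
- exists (fun=> 0); rewrite mmapC subrr big1 // => i _; exact: mul0r.
- exists (fun i => (i == j)%:R); rewrite mmapX mmap1U (bigD1 j) //= eqxx mul1r.
  by rewrite big1 ?addr0 // => i /negbTE->; rewrite mul0r.
- exists (fun i => a i + b i); rewrite rmorphD opprD addrACA aE bE -big_split.
  by apply: eq_bigr => i _; rewrite mulrDl.
exists (fun i => a i * q + mmap (@mpolyC n K) h p * b i).
transitivity ((p - mmap (@mpolyC n K) h p) * q
   + mmap (@mpolyC n K) h p * (q - mmap (@mpolyC n K) h q)).
  by rewrite rmorphM mulrBl mulrBr addrA subrK.
rewrite aE bE mulr_suml mulr_sumr -big_split; apply: eq_bigr => i _ /=.
by rewrite mulrDl mulrAC mulrA.
Qed.

Lemma hadamard x p : exists a : 'I_n -> {mpoly K[n]},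
  p = (p @@ x)%:MP + \sum_i a i * ('X_i - (x i 0)%:MP).
Proof.
have [a aE] := sub_subst_ideal (fun i => (x i 0)%:MP) p; exists a.
rewrite -aE addrC; suff -> : mmap (@mpolyC n K) (fun i => (x i 0)%:MP) p =
  (p @@ x)%:MP by rewrite subrK.
rewrite /meval /mmap raddf_sum; apply: eq_bigr => m _ /=.
by rewrite mpolyCM /mmap1 rmorph_prod; congr (_ * _);
   apply: eq_bigr => i _; rewrite rmorphXn.
Qed.

(** The monomials of degree less than k span the polynomials modulo the k-th
    power of the maximal ideal of x, although they are not centred at x. *)
Lemma truncation x k p : exists q, (msize q <= k)%N /\ ord_ge x k (p - q).
Proof.
elim: k p => [|k IHk] p; first by exists 0; rewrite msize0.
have [a aE] := hadamard x p.
have /fin_all_exists[b bP] (i : 'I_n) := IHk (a i).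
exists ((p @@ x)%:MP + \sum_i b i * ('X_i - (x i 0)%:MP)); split.
  apply: leq_trans (msizeD_le _ _) _; rewrite geq_max msizeC.
  rewrite (leq_trans (leq_b1 _)) //; apply: leq_trans (msize_sum _ _ _) _.
  apply/bigmax_leqP => i _; have [-> | nz_b] := eqVneq (b i) 0.
    by rewrite mul0r msize0.
  have [-> | nz_X] := eqVneq ('X_i - (x i 0)%:MP) 0; first by rewrite mulr0 msize0.
  rewrite msizeM //.
  have szX : (msize ('X_i - (x i 0%R)%:MP : {mpoly K[n]})%R <= 2)%N.
    apply: leq_trans (msizeD_le _ _) _.
    rewrite geq_max msizeX mdeg1 msizeN msizeC /=.
    by case: (_ == _).
  have [szb _] := bP i.
  by rewrite -subn1 leq_subLR add1n -addn2; apply: leq_add szb szX.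
rewrite {1}aE opprD addrACA subrr add0r -sumrB.
apply: ord_ge_sum => i; rewrite -mulrBl -addn1.
by apply: ord_geM (ord_ge_coord x i); apply: (bP i).2.
Qed.

(** Keeping the expansion as a list, with repeated exponents, avoids the
    multinomial coefficients. *)
Lemma iter_dirder_expansion gamma e : exists s : seq (K * 'X_{1..n}),
  (forall cm, cm \in s -> mdeg cm.2 = e) /\
  forall p, iter e (dirder gamma) p = \sum_(cm <- s) cm.1 *: p^`M[cm.2].
Proof.
elim: e => [|e [s [degs sE]]].
  exists [:: (1, 0%MM)]; split=> [cm|p].
    by rewrite inE => /eqP->; rewrite mdeg0.
  by rewrite big_seq1 scale1r mderivm0m.
exists [seq (gamma i 0%R * cm.1, (cm.2 + U_(i))%MM) | i <- index_enum 'I_n, cm <- s].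
split=> [_ /allpairsP[[i cm] /= [_ s_cm ->]]|p] /=.
  by rewrite mdegD mdeg1 degs ?addn1.
rewrite big_allpairs_dep /= /dirder; apply: eq_bigr => i _.
rewrite sE (raddf_sum (mderiv i)) scaler_sumr; apply: eq_bigr => cm _ /=.
by rewrite mderivZ scalerA mderivmDm mderivmU1m.
Qed.

End Polynomials.

(** * Differential operators and deflation matrices *)
Section Operators.
Variables (K : numFieldType) (n e : nat).
Implicit Types (p q : {mpoly K[n]}) (lambda : 'cV[K]_#|{: col_index n e}|).

Lemma col_exp_onto (m : 'X_{1..n}) : m != 0%MM -> (mdeg m <= e)%N ->
  exists c : 'I_#|{: col_index n e}|, col_exp c = m.
Proof.
rewrite -ltnS => nz_m lt_m.
pose b : col_index n e := exist _ (BMultinom lt_m) nz_m.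
by exists (enum_rank b); rewrite /col_exp enum_rankK.
Qed.

Lemma diff_op0 lambda : diff_op lambda 0 = 0.
Proof. by rewrite /diff_op big1 // => c _; rewrite raddf0 scaler0. Qed.

Lemma diff_opD lambda : {morph diff_op lambda : p q / p + q}.
Proof.
move=> p q; rewrite /diff_op -big_split; apply: eq_bigr => c _.
by rewrite raddfD scalerDr.
Qed.

Lemma diff_opZ lambda a p : diff_op lambda (a *: p) = a *: diff_op lambda p.
Proof.
rewrite /diff_op scaler_sumr; apply: eq_bigr => c _.
by rewrite linearZ !scalerA mulrC.
Qed.

Lemma diff_op_sum lambda I (r : seq I) (u : I -> {mpoly K[n]}) :
  diff_op lambda (\sum_(j <- r) u j) = \sum_(j <- r) diff_op lambda (u j).
Proof. by elim/big_rec2: _ => [|j _ v _ <-]; rewrite ?diff_op0 ?diff_opD. Qed.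

Lemma diff_op_mderiv lambda i p :
  diff_op lambda p^`M(i) = (diff_op lambda p)^`M(i).
Proof.
rewrite /diff_op (raddf_sum (mderiv i)); apply: eq_bigr => c _ /=.
by rewrite mderivZ -!mderivmU1m -!mderivmDm addmC.
Qed.

Lemma diff_op_dirder lambda gamma p :
  diff_op lambda (dirder gamma p) = dirder gamma (diff_op lambda p).
Proof.
rewrite diff_op_sum; apply: eq_bigr => i _.
by rewrite diff_opZ diff_op_mderiv.
Qed.

Lemma diff_op_ord_ge lambda x p : ord_ge x e.+1 p -> diff_op lambda p @@ x = 0.
Proof.
move=> op; rewrite /diff_op raddf_sum big1 // => c _ /=.
rewrite mevalZ -(coef0_on_line x 0) (@ord_ge_mderivm _ _ _ 1) ?mulr0 //.
apply: ord_ge_le op; rewrite add1n.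
exact: bmdeg.
Qed.

(** Iterated directional derivatives are the operators that will witness that
    the corank drops. *)
Lemma diff_op_iter_dirder gamma : (0 < e)%N ->
  exists lambda, forall p, diff_op lambda p = iter e (dirder gamma) p.
Proof.
move=> e_gt0; have [s [degs sE]] := iter_dirder_expansion gamma e.
suff [lambda lambdaE] : exists lambda, forall p,
  diff_op lambda p = \sum_(cm <- s) cm.1 *: p^`M[cm.2].
  by exists lambda => p; rewrite lambdaE sE.
elim: s degs {sE} => [|[a m] s IHs] degs.
  exists 0 => p; rewrite big_nil /diff_op big1 // => c _.
  by rewrite mxE scale0r.
have [|lambda lambdaE] := IHs.
  by move=> cm s_cm; rewrite degs ?inE ?s_cm ?orbT.
have deg_m : mdeg m = e by rewrite (degs (a, m)) ?mem_head.
have [||c cE] := @col_exp_onto m.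
- by rewrite -mdeg_eq0 deg_m -lt0n.
- by rewrite deg_m.
exists (a *: delta_mx c 0 + lambda) => p; rewrite big_cons -lambdaE /diff_op.
rewrite /= -cE.
under eq_bigr do rewrite !mxE scalerDl.
rewrite big_split /= (bigD1 c) //= !eqxx mulr1 big1 ?addr0 // => c' /negbTE ne.
by rewrite ne mulr0 scale0r.
Qed.

End Operators.

Section Kernels.
Variables (K : numFieldType) (n : nat).

Lemma rker_jacobian N (G : 'cV[{mpoly K[n]}]_N) x v :
  rker (eval_mx (jacobian G) x) v <-> forall j, dirder v (G j 0) @@ x = 0.
Proof.
have E j : (eval_mx (jacobian G) x *m v) j 0 = dirder v (G j 0) @@ x.
  rewrite mxE /dirder raddf_sum; apply: eq_bigr => i _ /=.
  by rewrite !mxE mevalZ mulrC.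
split=> [Av0 j|Av0]; first by rewrite -E Av0 mxE.
by apply/matrixP => j k; rewrite ord1 E mxE.
Qed.

Lemma rker_deflation N (F : 'cV[{mpoly K[n]}]_N) x e
    (lambda : 'cV[K]_#|{: col_index n e}|) :
  rker (eval_mx (deflation_mx F e) x) lambda <->
  forall r : 'I_#|{: row_index n N e}|, diff_op lambda (row_poly F r) @@ x = 0.
Proof.
have E (r : 'I_#|{: row_index n N e}|) :
    (eval_mx (deflation_mx F e) x *m lambda) r 0 =
    diff_op lambda (row_poly F r) @@ x.
  rewrite mxE /diff_op raddf_sum; apply: eq_bigr => c _ /=.
  by rewrite !mxE mevalZ mulrC.
split=> [Al0 r|Al0]; first by rewrite -E Al0 mxE.
by apply/matrixP => r k; rewrite ord1 E mxE.
Qed.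

Lemma row_poly_onto N (F : 'cV[{mpoly K[n]}]_N) e j (m : 'X_{1..n}) :
  (mdeg m < e)%N ->
  exists r : 'I_#|{: row_index n N e}|, row_poly F r = 'X_[m] * F j 0.
Proof.
move=> lt_m; pose b : row_index n N e := (j, BMultinom lt_m).
by exists (enum_rank b); rewrite /row_poly enum_rankK.
Qed.

Lemma eval_jacobian_augmented N (F : 'cV[{mpoly K[n]}]_N) x e
    (lambda : 'cV[K]_#|{: col_index n e}|) :
  eval_mx (jacobian (augmented F lambda)) x =
  col_mx (eval_mx (jacobian F) x)
    (eval_mx (jacobian (\col_r diff_op lambda (row_poly F r))) x).
Proof.
apply/matrixP => i j; rewrite !mxE.
by case: (split i) => k; rewrite !mxE.
Qed.

End Kernels.

Section CorankColMx.
Variables (K : fieldType) (m m' k : nat) (A : 'M[K]_(m, k)) (B : 'M[K]_(m', k)).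

(** Equality of ranks means that B factors through A, and this can be tested on
    the columns of the cokernel of A, which span its kernel. *)
Lemma corank_col_mx_lt :
  (corank (col_mx A B) < corank A)%N <-> exists v, rker A v /\ ~ rker B v.
Proof.
have le_rank : (\rank (col_mx A B) <= k)%N by exact: rank_leq_col.
have -> : (corank (col_mx A B) < corank A)%N = ~~ (B <= A)%MS.
  have sA : (A <= col_mx A B)%MS by rewrite -addsmxE addsmxSl.
  have := mxrank_leqif_sup sA; rewrite col_mx_sub submx_refl /= => -[le_r <-].
  by rewrite /corank; lia.
rewrite submxE; split=> [nzBA|[v [Av0 nzBv]]]; last first.
  apply/negP; rewrite -submxE => /submxP[D BE]; apply: nzBv.
  by rewrite /rker BE -mulmxA Av0 mulmx0.
have /existsP[j nz_j] : [exists j, B *m col j (cokermx A) != 0].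
  apply/contraNT: nzBA; rewrite negb_exists => /forallP B0; apply/eqP.
  apply/matrixP => i j; have:= B0 j; rewrite negbK colE mulmxA -colE.
  by move/eqP/matrixP/(_ i 0); rewrite !mxE.
exists (col j (cokermx A)); split; last by apply/eqP.
by rewrite /rker colE mulmxA mulmx_coker mul0mx.
Qed.

End CorankColMx.

(** * Local structure at a singular solution *)
Section LocalStructure.
Variables (K : numFieldType) (n N : nat) (F : 'cV[{mpoly K[n]}]_N) (x : 'cV[K]_n).
Implicit Types (p q : {mpoly K[n]}) (gamma v : 'cV[K]_n).
Hypothesis F_x : forall j, F j 0 @@ x = 0.

Local Notation A := (eval_mx (jacobian F) x).

Definition linear_part k : {mpoly K[n]} := \sum_i A k i *: ('X_i - (x i 0)%:MP).

Lemma ord_ge_linear_part k : ord_ge x 1 (linear_part k).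
Proof. by apply: ord_ge_sum => i; apply/ord_geZ/ord_ge_coord. Qed.

Lemma mderiv_linear_part k i : (linear_part k)^`M(i) = (A k i)%:MP.
Proof.
rewrite (raddf_sum (mderiv i)) (bigD1 i) //= big1 ?addr0 => [|j /negbTE ne].
  by rewrite mderivZ mderiv_coord eqxx -mul_mpolyC -mpolyCM mulr1.
by rewrite mderivZ mderiv_coord ne mpolyC0 scaler0.
Qed.

Lemma dirder_linear_part v k : rker A v -> dirder v (linear_part k) = 0.
Proof.
move=> Av0; rewrite /dirder.
transitivity ((A *m v) k 0)%:MP_[n]; last by rewrite Av0 mxE.
rewrite mxE rmorph_sum; apply: eq_bigr => i _ /=.
by rewrite mderiv_linear_part -mul_mpolyC -mpolyCM mulrC.
Qed.

(** The rows of the deflation matrix only cover the monomials of degree less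
    than e; the rest of p has order e and f_j has order one. *)
Lemma deflation_kills_ideal e (lambda : 'cV[K]_#|{: col_index n e}|) p j :
  rker (eval_mx (deflation_mx F e) x) lambda ->
  diff_op lambda (p * F j 0) @@ x = 0.
Proof.
move=> /rker_deflation Ql0.
have [q [szq ordr]] := truncation x e p.
rewrite -(subrK q p) mulrDl diff_opD mevalD diff_op_ord_ge ?add0r; last first.
  by rewrite -addn1; apply: ord_geM ordr (ord_ge1 _).
rewrite [q]mpolyE mulr_suml diff_op_sum raddf_sum big_seq big1 // => m q_m /=.
rewrite -scalerAl diff_opZ mevalZ.
have [|r <-] := @row_poly_onto _ _ _ F e j m; last by rewrite Ql0 mulr0.
exact: leq_trans (msize_mdeg_lt q_m) szq.
Qed.

Lemma on_line_subst (h : 'I_n -> {mpoly K[n]}) gamma gamma' p :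
  (forall i, on_line x gamma (h i) = on_line x gamma' 'X_i) ->
  on_line x gamma (mmap (@mpolyC n K) h p) = on_line x gamma' p.
Proof.
move=> hE; elim/mpoly_alg_ind: p => [c|i|p q IHp IHq|p q IHp IHq].
- by rewrite mmapC !on_lineC.
- by rewrite mmapX mmap1U hE.
- by rewrite mmapD !on_lineD IHp IHq.
- by rewrite rmorphM !on_lineM IHp IHq.
Qed.

Section Flat.
Variable d : nat.
Hypothesis d_gt0 : (0 < d)%N.
Hypothesis flat : forall gamma, rker A gamma ->
  forall j a, (a <= d)%N -> (on_line x gamma (F j 0))`_a = 0.

(** The substitution g is the projection of the space onto the kernel of the
    Jacobian matrix, written with a pseudo-inverse B.  It sends f_k into the
    power d + 1 of the maximal ideal, and X_i - g_i is a combination of the linear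
    parts, so f_k is h plus a combination of the linear parts with coefficients
    c' l.  Comparing derivatives at x shows that the constants c' l (x) recombine
    to the linear part of f_k. *)
Lemma flat_decomposition k : exists (c : 'I_N -> {mpoly K[n]}) h,
  [/\ forall l, ord_ge x 1 (c l), ord_ge x d.+1 h &
      F k 0 = linear_part k + \sum_l c l * linear_part l + h].
Proof.
pose B := pinvmx A; pose P : 'M_n := 1%:M - B *m A.
have AP : A *m P = 0.
  by rewrite mulmxBr mulmx1 mulmxA mulmxKpV ?submx_refl // subrr.
have PE i j : P i j = (1%:M : 'M[K]_n) i j - (B *m A) i j by rewrite /P !mxE.
pose g i : {mpoly K[n]} := (x i 0)%:MP + \sum_j P i j *: ('X_j - (x j 0)%:MP).
have gE gamma i : on_line x gamma (g i) = on_line x (P *m gamma) 'X_i.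
  rewrite /g on_lineD on_lineC on_lineX; congr (_ + _).
  rewrite (raddf_sum (on_line x gamma)) mxE scaler_suml.
  apply: eq_bigr => j _ /=; rewrite on_lineZ on_lineD on_lineX -mpolyCN on_lineC.
  by rewrite polyCN addrAC subrr add0r scalerA.
pose h := mmap (@mpolyC n K) g (F k 0).
have ord_h : ord_ge x d.+1 h.
  move=> gamma a lt_ad; rewrite (on_line_subst _ (gE gamma)) flat //.
  by rewrite /rker mulmxA AP mul0mx.
have [a aE] := sub_subst_ideal g (F k 0).
have XgE i : 'X_i - g i = \sum_l B i l *: linear_part l.
  transitivity (\sum_j (B *m A) i j *: ('X_j - (x j 0)%:MP : {mpoly K[n]})).
    rewrite /g opprD addrA.
    have {1}-> : 'X_i - (x i 0)%:MP =
        \sum_j (1%:M : 'M[K]_n) i j *: ('X_j - (x j 0)%:MP : {mpoly K[n]}).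
      rewrite (bigD1 i) //= mxE eqxx scale1r big1 ?addr0 // => j /negbTE ne.
      by rewrite mxE eq_sym ne scale0r.
    rewrite -sumrB; apply: eq_bigr => j _.
    by rewrite -scalerBl; rewrite PE opprB addrC subrK.
  under [RHS]eq_bigr do rewrite scaler_sumr.
  rewrite exchange_big; apply: eq_bigr => j _ /=.
  rewrite [X in X *: _]mxE scaler_suml; apply: eq_bigr => l _.
  by rewrite scalerA.
pose c' l := \sum_i B i l *: a i.
have FE : F k 0 = h + \sum_l c' l * linear_part l.
  apply/eqP; rewrite addrC -subr_eq aE; apply/eqP.
  under eq_bigr do rewrite XgE mulr_sumr.
  rewrite exchange_big; apply: eq_bigr => l _ /=.
  by rewrite /c' mulr_suml; apply: eq_bigr => i _; rewrite -scalerAr scalerAl.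
have AE i : A k i = \sum_l c' l @@ x * A l i.
  transitivity ((F k 0)^`M(i) @@ x); first by rewrite !mxE.
  rewrite {1}FE mderivD mevalD -(coef0_on_line x 0) (@ord_ge_mderiv _ _ _ 1) //.
    rewrite add0r (raddf_sum (mderiv i)) raddf_sum; apply: eq_bigr => l _ /=.
    rewrite mderivM mevalD !mevalM mderiv_linear_part mevalC.
    rewrite -[X in _ * X + _](coef0_on_line x 0) ord_ge_linear_part //.
    by rewrite mulr0 add0r.
  exact: ord_ge_le ord_h.
exists (fun l => c' l - (c' l @@ x)%:MP), h; split=> // [l|].
  by apply: ord_ge1; rewrite mevalB mevalC subrr.
suff -> : linear_part k = \sum_l (c' l @@ x)%:MP * linear_part l.
  rewrite -big_split /= FE addrC; congr (_ + _); apply: eq_bigr => l _.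
  by rewrite -mulrDl addrC subrK.
under eq_bigr do rewrite mul_mpolyC scaler_sumr.
rewrite exchange_big; apply: eq_bigr => i _ /=.
by rewrite AE scaler_suml; apply: eq_bigr => l _; rewrite scalerA.
Qed.

Section Operator.
Variables (e : nat) (lambda : 'cV[K]_#|{: col_index n e}|).
Hypothesis lambda_ker : rker (eval_mx (deflation_mx F e) x) lambda.

(** Descending induction on the order of p: the product of p with the linear part
    of f_k is p f_k, which is killed, up to products of linear parts with
    coefficients of higher order and terms of order greater than e. *)
Lemma deflation_kills_linear_part p k : (e <= d)%N ->
  diff_op lambda (p * linear_part k) @@ x = 0.
Proof.
move=> le_ed.
(* m counts down from e: for m = 0 the order of p is at least e. *)
suff H m : forall p k, ord_ge x (e - m) p ->
    diff_op lambda (p * linear_part k) @@ x = 0.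
  by apply: (H e); rewrite subnn.
elim: m => [|m IHm] {}p {}k.
  rewrite subn0 => ordp; apply: diff_op_ord_ge.
  by rewrite -addn1; apply: ord_geM ordp (ord_ge_linear_part k).
move=> ordp; have [c [h [ordc ordh FE]]] := flat_decomposition k.
have -> : p * linear_part k =
    p * F k 0 + - 1 *: (\sum_l (p * c l) * linear_part l + p * h).
  under eq_bigr do rewrite -mulrA; rewrite FE scaleN1r.
  by rewrite -mulr_sumr -mulrDr -mulrBr -(addrA (linear_part k)) addrK.
rewrite diff_opD diff_opZ diff_opD mevalD mevalZ mevalD.
rewrite deflation_kills_ideal // add0r diff_op_sum raddf_sum big1 => [|l _ /=].
  rewrite add0r diff_op_ord_ge ?mulr0 //.
  by apply: (@ord_ge_le _ _ _ _ (0 + d.+1)) => //; apply: ord_geM.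
apply: IHm; apply: (@ord_ge_le _ _ _ _ (e - m.+1 + 1)); first by lia.
exact: ord_geM.
Qed.

(** The linear parts are constant in the direction v, so the ideal that they
    generate is stable under the derivative, which lowers the order of the
    remainder only from d + 1 to d, still greater than e. *)
Lemma deflation_kills_dirder v p j : (e < d)%N -> rker A v ->
  diff_op lambda (dirder v (p * F j 0)) @@ x = 0.
Proof.
move=> lt_ed Av0; have [c [h [ordc ordh ->]]] := flat_decomposition j.
have killL q l : diff_op lambda (dirder v (q * linear_part l)) @@ x = 0.
  rewrite dirderM dirder_linear_part // mulr0 addr0.
  by apply: deflation_kills_linear_part; apply: ltnW.
rewrite !mulrDr mulr_sumr !dirderD !diff_opD !mevalD killL add0r.
rewrite dirder_sum diff_op_sum raddf_sum big1 ?add0r => [|l _ /=].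
  apply: diff_op_ord_ge; apply: ord_ge_sum => i; apply/ord_geZ/ord_ge_mderiv.
  by apply: (@ord_ge_le _ _ _ _ (0 + d.+1)) => //; apply: ord_geM.
by rewrite mulrA killL.
Qed.

Lemma deflation_keeps_corank : (e < d)%N ->
  ~ (corank (eval_mx (jacobian (augmented F lambda)) x) < corank A)%N.
Proof.
move=> lt_ed; rewrite eval_jacobian_augmented corank_col_mx_lt.
case=> v [Av0]; apply; apply/rker_jacobian => r.
by rewrite mxE -diff_op_dirder; apply: deflation_kills_dirder.
Qed.

End Operator.
End Flat.

(** With a left inverse B of the Jacobian matrix, the f_k written on the
    coordinates X_i - x_i have a matrix a' such that B a' is the identity at x.
    Multiplying by the adjugate, the determinant of B a', a unit at x, brings the
    X_i - x_i into the ideal; so the local algebra has dimension at most one. *)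
Lemma multiple_singular : is_multiple F x -> exists2 v, rker A v & v != 0.
Proof.
move=> [u uP]; have [fullA|] := boolP (row_full A); last first.
  rewrite -cokermx_eq0 => /eqP nz_coker.
  have /existsP[j nz_j] : [exists j, col j (cokermx A) != 0].
    apply/contra_notT: nz_coker; rewrite negb_exists => /forallP c0.
    apply/matrixP => i j; have:= c0 j; rewrite negbK => /eqP/matrixP/(_ i 0).
    by rewrite !mxE.
  by exists (col j (cokermx A)) => //; rewrite /rker colE mulmxA mulmx_coker mul0mx.
have /row_fullP[B BA] := fullA.
have nakayama p : p @@ x = 0 -> exists s : {mpoly K[n]},
    s @@ x != 0 /\ in_ideal F (s * p).
  move=> p_x; have [b bE] := hadamard x p.
  have /fin_all_exists[a aE] (k : 'I_N) := hadamard x (F k 0).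
  pose Y : 'cV[{mpoly K[n]}]_n := \col_i ('X_i - (x i 0)%:MP).
  pose b' : 'rV_n := \row_i b i; pose a' := \matrix_(k, i) a k i.
  pose B' := map_mx (@mpolyC n K) B; pose M := B' *m a'.
  have FE : F = a' *m Y.
    apply/matrixP => k j; rewrite ord1 aE F_x mpolyC0 add0r mxE.
    by apply: eq_bigr => i _; rewrite !mxE.
  have a'E : map_mx (meval (fun i => x i 0)) a' = A.
    apply/matrixP => k i; rewrite !mxE [in RHS]aE mderivD mderivC add0r.
    rewrite (raddf_sum (mderiv i)) raddf_sum /=.
    have termE l : (a k l * ('X_l - (x l 0)%:MP))^`M(i) @@ x =
        a k l @@ x * (l == i)%:R.
      rewrite mderivM mevalD !mevalM mevalB mevalXU mevalC subrr mulr0 add0r.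
      by rewrite mderiv_coord mevalC.
    under eq_bigr do rewrite termE.
    rewrite (bigD1 i) //= eqxx mulr1 big1 ?addr0 // => l /negbTE->.
    by rewrite mulr0.
  exists (\det M); split.
    rewrite -det_map_mx map_mxM a'E -map_mx_comp.
    suff -> : map_mx (meval (fun i => x i 0) \o @mpolyC n K) B = B.
      by rewrite BA det1 oner_neq0.
    by apply/matrixP => i j; rewrite !mxE /= mevalC.
  exists (fun j => (b' *m \adj M *m B') 0 j).
  transitivity ((b' *m \adj M *m B' *m F) 0 0); last by rewrite mxE.
  rewrite FE mulmxA -(mulmxA _ B') -/M -(mulmxA b') mul_adj_mx.
  rewrite -mulmxA mul_scalar_mx -scalemxAr [RHS]mxE; congr (_ * _).
  rewrite bE p_x mpolyC0 add0r mxE; apply: eq_bigr => i _.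
  by rewrite !mxE.
(* A nontrivial combination of u_0 and u_1 that vanishes at x. *)
pose c (i : 'I_2) : K := if u 0 @@ x == 0 then (i == 0)%:R
  else (if i == 0 then - (u 1 @@ x) else u 0 @@ x).
have c_eval : (\sum_i c i *: u i) @@ x = 0.
  rewrite raddf_sum /= big_ord_recl big_ord1 /= !mevalZ /c.
  have -> : lift ord0 ord0 = 1 :> 'I_2 by apply: val_inj.
  case: eqP => [->|_] /=; first by rewrite mulr0 mul0r addr0.
  by rewrite mulNr mulrC addNr.
have c0 := uP c (nakayama _ c_eval).
have := c0 1; have := c0 0; rewrite /c /=.
by case: eqP => //= _ /eqP; rewrite oner_eq0.
Qed.

End LocalStructure.

(** * Generic deflation operators *)
Section Genericity.
Variables (K : numFieldType) (k : nat).
Implicit Types (V Z : 'cV[K]_k -> Prop).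

(** If 0 is outside the closed set, then so is some nonzero multiple of w: a
    polynomial that does not vanish at 0 has finitely many zeros on the line of w. *)
Lemma generic_nonzero V P : (forall s v, V v -> V (s *: v)) ->
  (exists2 w, V w & w != 0) -> generic_in V P -> exists v, [/\ V v, v != 0 & P v].
Proof.
move=> scaleV [w Vw nz_w] [Z [[S ZE] [v [Vv nZv]] ZP]].
suff [u [Vu nz_u nZu]] : exists u, [/\ V u, u != 0 & ~ Z u].
  by exists u; split=> //; apply: ZP.
have [v0|nz_v] := eqVneq v 0; last by exists v.
have /existsNP[p /not_implyP[Sp nz_p]] : ~ forall p, S p -> p @@ v = 0.
  by move=> /ZE.
(* The factor X excludes the zero at s = 0. *)
have nz_q : on_line v w p * 'X != 0.
  rewrite mulf_neq0 ?polyX_eq0 //; apply/eqP => q0; apply: nz_p.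
  by rewrite -(coef0_on_line v w) q0 coef0.
have /existsNP[s /eqP] : ~ forall s, (on_line v w p * 'X).[s] = 0.
  by move/poly_vanish/eqP; apply/negP.
rewrite hornerM hornerX mulf_eq0 negb_or horner_on_line v0 add0r.
case/andP=> nz_ps nz_s.
exists (s *: w); split; first exact: scaleV.
  by rewrite scaler_eq0 negb_or nz_s.
by move/ZE/(_ p Sp)/eqP; apply/negP.
Qed.

End Genericity.

Section MinimalOrder.
Variables (K : numFieldType) (n N : nat) (F : 'cV[{mpoly K[n]}]_N) (x : 'cV[K]_n).
Hypothesis F_x : forall j, F j 0 @@ x = 0.

Local Notation A := (eval_mx (jacobian F) x).

Section Direction.
Variables (d : nat) (gamma : 'cV[K]_n) (j : 'I_N).
Hypothesis d_gt0 : (0 < d)%N.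
Hypothesis flat : forall gamma, rker A gamma ->
  forall j a, (a <= d)%N -> (on_line x gamma (F j 0))`_a = 0.
Hypothesis gamma_ker : rker A gamma.
Hypothesis gamma_leaves : (on_line x gamma (F j 0))`_d.+1 != 0.

Lemma iter_dirder_leaves : iter d.+1 (dirder gamma) (F j 0) @@ x != 0.
Proof.
by rewrite eval_iter_dirder mulrn_eq0 negb_or -lt0n fact_gt0.
Qed.

(** On x^alpha f_j, the coefficient of t^e along gamma vanishes since f_j has
    order d + 1 > e on the line. *)
Lemma directional_deflation e : (0 < e)%N -> (e <= d)%N -> exists lambda,
  rker (eval_mx (deflation_mx F e) x) lambda /\
  forall p, diff_op lambda p = iter e (dirder gamma) p.
Proof.
move=> e_gt0 le_ed; have [lambda lambdaE] := diff_op_iter_dirder gamma e_gt0.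
exists lambda; split=> //; apply/rker_deflation => r.
rewrite lambdaE eval_iter_dirder on_lineM coefM big1 ?mul0rn // => b _.
by rewrite flat ?mulr0 // (leq_trans (leq_subr _ _)).
Qed.

(** The closed set is the hyperplane of the lambda such that the operator
    d_gamma Q_lambda kills f_j at x; outside it, gamma leaves the kernel of the
    augmented Jacobian matrix through the row of f_j itself. *)
Lemma deflation_lowers_corank : generic_deflation_lowers_corank F x d.
Proof.
pose L : {mpoly K[#|{: col_index n d}|]} :=
  \sum_c dirder gamma (F j 0)^`M[col_exp c] @@ x *: 'X_c.
have LE (lambda : 'cV[K]_#|{: col_index n d}|) :
    L @@ lambda = dirder gamma (diff_op lambda (F j 0)) @@ x.
  rewrite -diff_op_dirder /diff_op /L (raddf_sum (meval _)).
  rewrite [RHS](raddf_sum (meval _)); apply: eq_bigr => c _ /=.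
  rewrite !mevalZ mevalXU mulrC.
  congr (_ * meval _ _).
  rewrite /dirder (raddf_sum (mderivm _)); apply: eq_bigr => i _ /=.
  by rewrite linearZ /= -!mderivmU1m -!mderivmDm addmC.
have [lambda [kerl lE]] := directional_deflation d_gt0 (leqnn d).
exists (fun lambda => L @@ lambda = 0); split.
- exists (eq L) => v; split=> [Lv p <- //|]; exact.
- exists lambda; split=> //; apply/eqP.
  by rewrite LE lE iter_dirder_leaves.
move=> {kerl lE}lambda _ nzL _.
rewrite eval_jacobian_augmented corank_col_mx_lt; exists gamma; split=> //.
move/rker_jacobian; have [|r rE] := @row_poly_onto _ _ _ F d j 0%MM.
  by rewrite mdeg0.
by move/(_ r); rewrite mxE rE mpolyX0 mul1r -LE.
Qed.

(** A nonzero element of the kernel is needed because genericity says nothing on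
    lambda = 0; the directional derivative of order e provides one. *)
Lemma deflation_order_ge e : (0 < e)%N ->
  generic_deflation_lowers_corank F x e -> (d <= e)%N.
Proof.
move=> e_gt0 lowers; rewrite leqNgt; apply/negP => lt_ed.
have [mu [kerm mE]] := directional_deflation e_gt0 (ltnW lt_ed).
have [||lambda [kerl nz_l lowers_l]] := generic_nonzero _ _ lowers.
- by move=> s v Av0; rewrite /rker -scalemxAr Av0 scaler0.
- exists mu => //; apply/eqP => mu0; have /eqP := iter_dirder_leaves; apply.
  have iter0 k : iter k (dirder gamma) 0 = 0.
    by elim: k => //= k ->; rewrite dirder0.
  rewrite -(subnK (leqW (ltnW lt_ed))) iterD -mE mu0 /diff_op big1 ?iter0 ?meval0 //.
  by move=> c _; rewrite mxE scale0r.
by apply: (deflation_keeps_corank F_x d_gt0 flat kerl lt_ed); apply: lowers_l.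
Qed.

End Direction.

(** Otherwise every point of the line solves the system. *)
Lemma isolated_leaves gamma : isolated_solution F x -> gamma != 0 ->
  exists j a, (on_line x gamma (F j 0))`_a != 0.
Proof.
move=> [_ [eps [eps_gt0 isolated]]] nz_gamma.
apply: contrapT => noja; move: nz_gamma; apply/negP; rewrite negbK.
have on_F s : is_solution F (x + s *: gamma).
  apply/matrixP => j k; rewrite ord1 !mxE -horner_on_line.
  suff -> : on_line x gamma (F j 0) = 0 by rewrite horner0.
  apply/polyP => a; rewrite coef0; apply: contrapT => /eqP nz.
  by apply: noja; exists j, a.
(* The step eps / r keeps every coordinate of the increment below eps. *)
pose r := 1 + \sum_i `|gamma i 0|.
have r_gt0 : 0 < r by rewrite ltr_pwDl ?ltr01 ?sumr_ge0.
have := isolated _ (on_F (eps / r)).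
have -> : (x + (eps / r) *: gamma = x) <-> gamma = 0.
  split=> [/(canRL (addKr _))|->]; last by rewrite scaler0 addr0.
  rewrite addNr => /eqP; rewrite scaler_eq0 mulf_eq0 invr_eq0.
  by rewrite (gt_eqF eps_gt0) (gt_eqF r_gt0) => /eqP.
move=> H; apply/eqP/H => i.
rewrite !mxE addrAC subrr add0r normrM gtr0_norm ?divr_gt0 //.
rewrite mulrAC ltr_pdivrMr // ltr_pM2l // /r (bigD1 i) //=.
rewrite addrCA ltrDl ltr_pwDl ?ltr01 // sumr_ge0 //.
Qed.

End MinimalOrder.

Lemma generic_direction_detects_order (K : numFieldType) (n N : nat)
    (F : 'cV[{mpoly K[n]}]_N) (x : 'cV[K]_n) :
  isolated_solution F x -> is_multiple F x ->
  generic_in (rker (eval_mx (jacobian F) x)) (fun gamma =>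
    exists d : nat,
      is_min (line_support (line_restriction F x gamma)) d.+1 /\
      is_min (fun e => (0 < e)%N /\ generic_deflation_lowers_corank F x e) d).
Proof.
move=> isol mult; have F_x j : F j 0 @@ x = 0.
  by have /matrixP/(_ j 0) := isol.1; rewrite !mxE.
set A := eval_mx _ _.
pose leaves a := exists gamma j, rker A gamma /\ (on_line x gamma (F j 0))`_a != 0.
have ex_leaves : exists a, `[< leaves a >].
  have [gamma Ag nz_g] := multiple_singular F_x mult.
  have [j [a nz_a]] := isolated_leaves isol nz_g.
  by exists a; apply/asboolP; exists gamma, j.
case: (ex_minnP ex_leaves) => a /asboolP[gamma [j [Ag nz_a]]] min_a.
have flat gamma' : rker A gamma' -> forall j b, (b < a)%N ->
    (on_line x gamma' (F j 0))`_b = 0.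
  move=> Ag' j1 b; rewrite ltnNge => /negP lt_ba; apply: contrapT => /eqP nz_b.
  by apply/lt_ba/min_a/asboolP; exists gamma', j1.
(* Orders 0 and 1 are excluded: x is a solution and gamma is in the kernel. *)
case: a nz_a min_a flat => [|[|a]] nz_a min_a flat.
- by rewrite coef0_on_line F_x eqxx in nz_a.
- rewrite -[_`_1]mulr1n -coef_on_line_dirder coef0_on_line in nz_a.
  by move/rker_jacobian: Ag nz_a => ->; rewrite eqxx.
have /fin_all_exists[c cP] (k : 'I_N) := coef_on_line_polynomial x (F k 0) a.+2.
exists (fun v => forall k, c k @@ v = 0); split.
- exists (fun p => exists k, p = c k) => v.
  by split=> [cv p [k ->]|cv k]; [exact: cv|apply: cv; exists k].
- exists gamma; split=> // /(_ j) /eqP; apply/negP.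
  by rewrite (cP j).1.
move=> gamma' Ag' /existsNP[k /eqP]; rewrite (cP k).1 => nz_k; exists a.+1.
split; split.
- by exists k; rewrite mxE -on_lineE.
- move=> b [l]; rewrite mxE -on_lineE => nz_b; rewrite leqNgt; apply/negP => lt_b.
  by rewrite flat ?eqxx in nz_b.
- by split=> //; apply: deflation_lowers_corank nz_k.
by move=> e [e_gt0]; apply: deflation_order_ge nz_k e e_gt0.
Qed.

Unset Implicit Arguments.

Theorem mainTheorem2 (R : realType) (n N : nat)
    (F : 'cV[{mpoly (R[i])[n]}]_N) (x : 'cV[R[i]]_n)
    (x_isolated : isolated_solution F x) (x_multiple : is_multiple F x) :
  generic_in (rker (eval_mx (jacobian F) x)) (fun gamma : 'cV[R[i]]_n =>
    exists d : nat,
      is_min (line_support (line_restriction F x gamma)) d.+1 /\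
      is_min (fun e => (0 < e)%N /\ generic_deflation_lowers_corank F x e) d).
Proof. exact: generic_direction_detects_order. Qed.
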